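(* The category $\mathcal{NSH}_0^{\vee}$, whose objects are Stonean Hilbert algebras and whose arrows are $\neg$-morphisms, is dually equivalent to the category $\mathcal{NMS}_0^{\vee}$, whose objects are Stonean $H_0^{\vee}$-spaces and whose arrows are $\neg$-maps.
   Context: A Hilbert algebra is an algebra $\langle A,\to,1\rangle$ of type $(2,0)$ such that for all $a,b,c\in A$: $a\to(b\to a)=1$; $(a\to(b\to c))\to((a\to b)\to(a\to c))=1$; and $a\to b=b\to a=1$ implies $a=b$. Its natural order is: $a\le b$ iff $a\to b=1$. An $H^{\vee}$-algebra is an algebra $\langle A,\to,\vee,1\rangle$ where $\langle A,\to,1\rangle$ is a Hilbert algebra, $\langle A,\vee,1\rangle$ is a join-semilattice with greatest element $1$, and $a\to b=1$ iff $a\vee b=b$ for all $a,b$. An $H_0^{\vee}$-algebra is an $H^{\vee}$-algebra with an element $0$ such that $0\to a=1$ for all $a$; write $\neg a:=a\to 0$. A Stonean Hilbert algebra is an $H_0^{\vee}$-algebra satisfying $\neg a\vee\neg\neg a=1$ for all $a$. A map $h\colon A\to B$ between $H_0^{\vee}$-algebras is a $\neg$-morphism if for all $a,b\in A$: $h(1)=1$; $h(a\to b)\le h(a)\to h(b)$; $h(a\vee b)=h(a)\vee h(b)$; $h(\neg a)=\neg h(a)$. For a topological space $\langle X,\mathcal{T}_{\mathcal{K}}\rangle$ with a base $\mathcal{K}$, let $D(X)=\{U\subseteq X\colon U^c\in\mathcal{K}\}$, where $U^c=X\setminus U$. Order $X$ by $x\le y$ iff $y\in\mathrm{cl}(\{x\})$.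 For $Y\subseteq X$, $(Y]=\{x\in X\colon \exists y\in Y,\ x\le y\}$. The space $\langle X,\mathcal{T}_{\mathcal{K}}\rangle$ is an $H_0^{\vee}$-space if: $\mathcal{K}$ is a base of open and compact subsets for $\mathcal{T}_{\mathcal{K}}$; for all $U,V\in\mathcal{K}$, $U\cap V\in\mathcal{K}$ and $(U\cap V^c]^c\in D(X)$; $X\in\mathcal{K}$; and $\langle X,\mathcal{T}_{\mathcal{K}}\rangle$ is sober (every irreducible closed set is the closure of a unique point). It is a Stonean $H_0^{\vee}$-space if moreover $(U]\in D(X)$ for all $U\in D(X)$. A map $f\colon X_1\to X_2$ between $H_0^{\vee}$-spaces with bases $\mathcal{K}_1,\mathcal{K}_2$ is spectral if $f^{-1}(U)\in\mathcal{K}_1$ for all $U\in\mathcal{K}_2$. A $\neg$-map between Stonean $H_0^{\vee}$-spaces is a spectral map $f\colon X_1\to X_2$ such that for all $x\in X_1$, $y\in X_2$ with $f(x)\le y$ there exists $z\in X_1$ with $x\le z$ and $y\le f(z)$. *)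

(* Defs.v *)
From HB Require Import structures.
From mathcomp Require Import all_boot.
From mathcomp Require Import all_classical.
From mathcomp Require Import topology.

Set Implicit Arguments.
Unset Strict Implicit.
Unset Printing Implicit Defensive.

Local Open Scope classical_set_scope.

Declare Scope hilbert_scope.
Delimit Scope hilbert_scope with hilbert.
Local Open Scope hilbert_scope.

HB.mixin Record isHilbertAlgebra (A : Type) := {
  himp : A -> A -> A;
  hone : A;
  himpK : forall a b, himp a (himp b a) = hone;
  himpS : forall a b c,
    himp (himp a (himp b c)) (himp (himp a b) (himp a c)) = hone;
  himp_anti : forall a b, himp a b = hone -> himp b a = hone -> a = b
}.

#[short(type="hilbertAlgType")]
HB.structure Definition HilbertAlgebra := {A of isHilbertAlgebra A}.

Notation "a =>> b" := (himp a b)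
  (at level 55, right associativity) : hilbert_scope.

Definition hle (A : hilbertAlgType) (a b : A) : Prop := a =>> b = hone.

Notation "a <=h b" := (hle a b) (at level 70) : hilbert_scope.

HB.mixin Record Hilbert_isHVee (A : Type) & HilbertAlgebra A := {
  hjoin : A -> A -> A;
  hjoinA : associative hjoin;
  hjoinC : commutative hjoin;
  hjoinI : idempotent_op hjoin;
  hjoin1 : right_zero (hone : A) hjoin;
  hleEjoin : forall a b : A, a =>> b = hone <-> hjoin a b = b
}.

#[short(type="hveeAlgType")]
HB.structure Definition HVeeAlgebra :=
  {A of HilbertAlgebra A & Hilbert_isHVee A}.

Notation "a +v b" := (hjoin a b)
  (at level 50, left associativity) : hilbert_scope.

HB.mixin Record HVee_isH0Vee (A : Type) & HVeeAlgebra A := {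
  hzero : A;
  hzero_le : forall a : A, hzero =>> a = hone
}.

#[short(type="h0veeAlgType")]
HB.structure Definition H0VeeAlgebra := {A of HVeeAlgebra A & HVee_isH0Vee A}.

Definition hneg (A : h0veeAlgType) (a : A) : A := a =>> hzero.

HB.mixin Record H0Vee_isStonean (A : Type) & H0VeeAlgebra A := {
  hneg_stone : forall a : A, hneg a +v hneg (hneg a) = hone
}.

#[short(type="stoneanHilbertType")]
HB.structure Definition StoneanHilbert :=
  {A of H0VeeAlgebra A & H0Vee_isStonean A}.

Definition neg_morphism (A B : h0veeAlgType) (h : A -> B) : Prop :=
  [/\ h hone = hone,
      forall a b, h (a =>> b) <=h h a =>> h b,
      forall a b, h (a +v b) = h a +v h b
    & forall a, h (hneg a) = hneg (h a)].

Definition specialization (X : topologicalType) (x y : X) : Prop :=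
  closure [set x] y.

Definition downset (X : topologicalType) (Y : set X) : set X :=
  [set x | exists2 y, Y y & specialization x y].

(* The empty set is not irreducible, so that the empty space is sober. *)
Definition irreducible (X : topologicalType) (Y : set X) : Prop :=
  Y !=set0 /\
  forall F G : set X, closed F -> closed G -> Y = F `|` G -> Y = F \/ Y = G.

Definition sober (X : topologicalType) : Prop :=
  forall Y : set X, closed Y -> irreducible Y ->
  exists! x, Y = closure [set x].

Definition dual_base (X : Type) (K : set (set X)) : set (set X) :=
  [set U | K (~` U)].

HB.mixin Record Topological_isH0VeeSpace (X : Type) & Topological X := {
  sbase : set (set X);
  sbase_basis : basis (sbase : set (set X));
  sbase_compact : forall U : set X, sbase U -> compact U;
  sbaseI : forall U V : set X, sbase U -> sbase V -> sbase (U `&` V);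
  sbase_imp : forall U V : set X, sbase U -> sbase V ->
    dual_base sbase (~` downset (U `&` ~` V));
  sbaseT : sbase setT;
  sbase_sober : sober X
}.

#[short(type="h0veeSpaceType")]
HB.structure Definition H0VeeSpace :=
  {X of Topological X & Topological_isH0VeeSpace X}.

Definition DX (X : h0veeSpaceType) : set (set X) := dual_base (@sbase X).

HB.mixin Record H0VeeSpace_isStonean (X : Type) & H0VeeSpace X := {
  DX_downset : forall U : set X, DX U -> DX (downset U)
}.

#[short(type="stoneanSpaceType")]
HB.structure Definition StoneanSpace :=
  {X of H0VeeSpace X & H0VeeSpace_isStonean X}.

Definition spectral (X1 X2 : h0veeSpaceType) (f : X1 -> X2) : Prop :=
  forall U : set X2, sbase U -> sbase (f @^-1` U).

Definition neg_map (X1 X2 : stoneanSpaceType) (f : X1 -> X2) : Prop :=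
  spectral f /\
  forall (x : X1) (y : X2), specialization (f x) y ->
    exists z : X1, specialization x z /\ specialization y (f z).

Record category := Category {
  obj :> Type;
  hom : obj -> obj -> Type;
  idm : forall a, hom a a;
  compm : forall a b c, hom b c -> hom a b -> hom a c;
  comp_idl : forall a b (f : hom a b), compm (idm b) f = f;
  comp_idr : forall a b (f : hom a b), compm f (idm a) = f;
  compA : forall a b c d (h : hom c d) (g : hom b c) (f : hom a b),
    compm h (compm g f) = compm (compm h g) f
}.

Arguments idm {c0} a.
Arguments compm {c0 a b c} g f.

Definition opposite (C : category) : category :=
  @Category C (fun a b => hom b a) (@idm C) (fun _ _ _ g f => compm f g)
    (fun _ _ f => comp_idr f) (fun _ _ f => comp_idl f)
    (fun _ _ _ _ h g f => esym (compA f g h)).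

Record functor (C D : category) := Functor {
  fobj :> C -> D;
  fmap : forall a b : C, hom a b -> hom (fobj a) (fobj b);
  fmap_id : forall a, fmap (idm a) = idm (fobj a);
  fmap_comp : forall (a b c : C) (g : hom b c) (f : hom a b),
    fmap (compm g f) = compm (fmap g) (fmap f)
}.

Arguments fmap {C D} F {a b} f : rename.

Definition functor_id (C : category) : functor C C :=
  @Functor C C id (fun _ _ f => f) (fun _ => erefl) (fun _ _ _ _ _ => erefl).

Lemma functor_comp_id (C D E : category) (G : functor D E) (F : functor C D)
  (a : C) : fmap G (fmap F (idm a)) = idm (G (F a)).
Proof. by rewrite !fmap_id. Qed.

Lemma functor_comp_comp (C D E : category) (G : functor D E) (F : functor C D)
    (a b c : C) (g : hom b c) (f : hom a b) :
  fmap G (fmap F (compm g f)) = compm (fmap G (fmap F g)) (fmap G (fmap F f)).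
Proof. by rewrite !fmap_comp. Qed.

Definition functor_comp (C D E : category) (G : functor D E) (F : functor C D) :
    functor C E :=
  @Functor C E (fun a => G (F a)) (fun _ _ f => fmap G (fmap F f))
    (functor_comp_id G F) (functor_comp_comp G F).

Definition is_iso (C : category) (a b : C) (f : hom a b) : Prop :=
  exists g : hom b a, compm g f = idm a /\ compm f g = idm b.

Definition naturally_isomorphic (C D : category) (F G : functor C D) : Prop :=
  exists eta : forall a : C, hom (F a) (G a),
    (forall (a b : C) (f : hom a b),
       compm (eta b) (fmap F f) = compm (fmap G f) (eta a)) /\
    (forall a : C, is_iso (eta a)).

Definition equivalent (C D : category) : Prop :=
  exists (F : functor C D) (G : functor D C),
    naturally_isomorphic (functor_comp G F) (functor_id C) /\
    naturally_isomorphic (functor_comp F G) (functor_id D).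

Definition dually_equivalent (C D : category) : Prop :=
  equivalent (opposite C) D.

Lemma hle_trans (A : hveeAlgType) (b a c : A) : a <=h b -> b <=h c -> a <=h c.
Proof.
by move=> /hleEjoin ab /hleEjoin bc; apply/hleEjoin; rewrite -bc hjoinA ab.
Qed.

Lemma neg_morphism_id (A : h0veeAlgType) : neg_morphism (@id A).
Proof. by split=> // a b; apply/hleEjoin; rewrite hjoinI. Qed.

Lemma neg_morphism_comp (A B C : h0veeAlgType) (g : B -> C) (f : A -> B) :
  neg_morphism g -> neg_morphism f -> neg_morphism (g \o f).
Proof.
move=> [g1 gi gj gn] [f1 fi fj fn]; split=> /= [|a b|a b|a].
- by rewrite f1 g1.
- apply: hle_trans (gi _ _); apply/hleEjoin.
  by rewrite -gj; congr g; apply/hleEjoin; exact: fi.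
- by rewrite fj gj.
- by rewrite fn gn.
Qed.

Definition NSH_hom (A B : stoneanHilbertType) : Type :=
  {h : A -> B | neg_morphism h}.

Definition NSH_id (A : stoneanHilbertType) : NSH_hom A A :=
  exist _ id (neg_morphism_id A).

Definition NSH_comp (A B C : stoneanHilbertType)
    (g : NSH_hom B C) (f : NSH_hom A B) : NSH_hom A C :=
  exist _ (sval g \o sval f) (neg_morphism_comp (svalP g) (svalP f)).

Lemma NSH_idl (A B : stoneanHilbertType) (f : NSH_hom A B) :
  NSH_comp (NSH_id B) f = f.
Proof. by case: f => f Hf; exact: eq_exist. Qed.

Lemma NSH_idr (A B : stoneanHilbertType) (f : NSH_hom A B) :
  NSH_comp f (NSH_id A) = f.
Proof. by case: f => f Hf; exact: eq_exist. Qed.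

Lemma NSH_compA (A B C D : stoneanHilbertType)
    (h : NSH_hom C D) (g : NSH_hom B C) (f : NSH_hom A B) :
  NSH_comp h (NSH_comp g f) = NSH_comp (NSH_comp h g) f.
Proof. exact: eq_exist. Qed.

Definition NSH : category := Category NSH_idl NSH_idr NSH_compA.

Lemma spectral_specialization (X1 X2 : h0veeSpaceType) (f : X1 -> X2) x y :
  spectral f -> specialization x y -> specialization (f x) (f y).
Proof.
move=> fs xy B /(proj2 (@sbase_basis X2))[U [KU Ufy] UB].
have [_ [-> Ufx]] : [set x] `&` (f @^-1` U) !=set0.
  apply: xy; apply: open_nbhs_nbhs; split=> //.
  by apply: (proj1 (@sbase_basis X1)); exact: fs.
by exists (f x); split=> //; exact: UB.
Qed.

Lemma specialization_refl (X : topologicalType) (x : X) : specialization x x.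
Proof. exact: subset_closure. Qed.

Lemma specialization_trans (X : topologicalType) (y x z : X) :
  specialization x y -> specialization y z -> specialization x z.
Proof.
move=> xy yz; have /closure_id cE := @closed_closure _ [set x].
rewrite /specialization cE.
by move: z yz; apply: closureS => _ ->.
Qed.

Lemma neg_map_id (X : stoneanSpaceType) : neg_map (@id X).
Proof. by split=> // x y xy; exists y; split=> //; exact: specialization_refl. Qed.

Lemma neg_map_comp (X Y Z : stoneanSpaceType) (g : Y -> Z) (f : X -> Y) :
  neg_map g -> neg_map f -> neg_map (g \o f).
Proof.
move=> [gs gn] [fs fn]; split=> [U KU|x z /gn[y [/fn[w [xw yw]] zy]]].
  exact: fs (gs _ KU).
by exists w; split=> //; apply: specialization_trans zy (spectral_specialization gs yw).
Qed.

Definition NMS_hom (X Y : stoneanSpaceType) : Type :=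
  {f : X -> Y | neg_map f}.

Definition NMS_id (X : stoneanSpaceType) : NMS_hom X X :=
  exist _ id (neg_map_id X).

Definition NMS_comp (X Y Z : stoneanSpaceType)
    (g : NMS_hom Y Z) (f : NMS_hom X Y) : NMS_hom X Z :=
  exist _ (sval g \o sval f) (neg_map_comp (svalP g) (svalP f)).

Lemma NMS_idl (X Y : stoneanSpaceType) (f : NMS_hom X Y) :
  NMS_comp (NMS_id Y) f = f.
Proof. by case: f => f Hf; exact: eq_exist. Qed.

Lemma NMS_idr (X Y : stoneanSpaceType) (f : NMS_hom X Y) :
  NMS_comp f (NMS_id X) = f.
Proof. by case: f => f Hf; exact: eq_exist. Qed.

Lemma NMS_compA (X Y Z W : stoneanSpaceType)
    (h : NMS_hom Z W) (g : NMS_hom Y Z) (f : NMS_hom X Y) :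
  NMS_comp h (NMS_comp g f) = NMS_comp (NMS_comp h g) f.
Proof. exact: eq_exist. Qed.

Definition NMS : category := Category NMS_idl NMS_idr NMS_compA.

(* Main.v *)
From HB Require Import structures.
From mathcomp Require Import all_boot.
From mathcomp Require Import all_classical.
From mathcomp Require Import topology.
Require Import Defs.

(** The duality is of Stone type: the points of the space of an algebra A are
    the prime implicative filters of A, and the elements of the algebra of a
    space X are the sets in D(X). The two natural isomorphisms are
    [phi a = {P | a in P}] and [epsilon x = {U | x in U}].

    Everything about the spectrum rests on one form of Zorn's lemma,
    [exists_maximal_avoiding]: a filter F omitting b extends to a filter M
    maximal among those that omit b. Such an M is prime
    ([maximal_avoiding_prime]), and for each c outside M it contains c -> b.
    Applied to the filter generated by P and a, it shows that P omits a -> b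
    exactly when some prime filter above P contains a and omits b. As the
    specialization order of the spectrum is inclusion, this says that phi turns
    -> into the implication of D(X) ([downset_phiD]); applied to {1} it shows
    that phi is injective ([phi_le]), and phi is onto by the choice of the base.
    Compactness of the basic opens comes from ultrafilters, which define prime
    filters ([compact_phiC]), and sobriety from the fact that the elements a
    with Y contained in [phi a] form a prime filter when Y is irreducible
    ([sober_spectrum]).

    On the side of spaces, the implication of D(X) is the Kripke implication
    over the specialization order, which makes the axioms of a Hilbert algebra
    immediate. The map epsilon is injective because the space is T0. It is onto
    because a prime filter of D(X) is determined by its intersection Y: by
    compactness of basic opens, every U in D(X) containing Y is in the filter
    ([filter_compact]); hence Y is irreducible and its generic point is the
    preimage ([epsilon_surj]).

    The Stone identity enters twice. On objects, it says that every prime filter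
    contains exactly one of the negation and the double negation of a, which
    gives (phi a] as the set of the double negation of a, and so puts it in D
    of the spectrum. On arrows, a maximal proper filter contains every element
    whose double negation it contains, and this yields the lifting property of
    the map dual to a morphism that preserves negation
    ([neg_map_spectrum_map]). *)

Set Implicit Arguments.
Unset Strict Implicit.
Unset Printing Implicit Defensive.

Local Open Scope classical_set_scope.
Local Open Scope hilbert_scope.

(** * Order and implication in algebras with join *)

Section HVeeTheory.
Variable A : hveeAlgType.
Implicit Types a b c d : A.

Lemma hle_refl a : a <=h a.
Proof. by apply/hleEjoin; rewrite hjoinI. Qed.

Lemma hle1 a : a <=h hone.
Proof. by apply/hleEjoin; rewrite hjoin1. Qed.

Lemma himp1 a : hone =>> a = a.
Proof.
apply: himp_anti; last exact: himpK.
have mp b : hone =>> b = hone -> b = hone.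
  by move=> h; apply: himp_anti h; exact: hle1.
have := himpS (hone =>> a) hone a.
by rewrite (hle_refl (hone =>> a)) hle1 => /mp/mp.
Qed.

Lemma hle_imp2l a b c : b <=h c -> a =>> b <=h a =>> c.
Proof.
move=> bc; have := himpS a b c.
by rewrite [b =>> c]bc hle1 himp1.
Qed.

Lemma hle_exchange a b c : a <=h b =>> c -> b <=h a =>> c.
Proof.
move=> abc; apply: (@hle_trans _ (a =>> b)); first exact: himpK.
by have := himpS a b c; rewrite [a =>> (b =>> c)]abc himp1.
Qed.

Lemma hle_imp2r a b c : a <=h b -> b =>> c <=h a =>> c.
Proof.
by move=> ab; apply: hle_exchange; apply: hle_trans ab _; apply: hle_exchange;
  exact: hle_refl.
Qed.

Lemma himp_exchange a b c : a =>> (b =>> c) <=h b =>> (a =>> c).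
Proof. exact: hle_trans (himpS a b c) (hle_imp2r _ (himpK b a)). Qed.

Lemma hle_joinl a b : a <=h a +v b.
Proof. by apply/hleEjoin; rewrite hjoinA hjoinI. Qed.

Lemma hle_joinr a b : b <=h a +v b.
Proof. by rewrite hjoinC; exact: hle_joinl. Qed.

Lemma hjoin_le a b c : a <=h c -> b <=h c -> a +v b <=h c.
Proof.
by move=> /hleEjoin ac /hleEjoin bc; apply/hleEjoin; rewrite -hjoinA bc.
Qed.

(** The join satisfies its elimination rule in curried form, because a Hilbert
    algebra has no meet with which to combine the two premises. *)
Lemma hjoin_elim a b c : a =>> c <=h (b =>> c) =>> ((a +v b) =>> c).
Proof.
apply: hle_trans (himp_exchange _ _ _); apply: hle_exchange; apply: hjoin_le.
  apply: (@hle_trans _ ((a =>> c) =>> c)); last exact: hle_imp2l (himpK _ _).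
  by apply: hle_exchange; exact: hle_refl.
apply: (@hle_trans _ ((b =>> c) =>> c)); last exact: himpK.
by apply: hle_exchange; exact: hle_refl.
Qed.

End HVeeTheory.

(** * Implicative filters and the prime filter theorem *)

Section Filters.
Variable A : hveeAlgType.
Implicit Types (F : set A) (a b c : A).

Definition implicative_filter F :=
  F hone /\ forall a b, F a -> F (a =>> b) -> F b.

Lemma filter_le F a b : implicative_filter F -> a <=h b -> F a -> F b.
Proof. by move=> [F1 Fmp] ab Fa; apply: (Fmp _ _ Fa); rewrite [_ =>> _]ab. Qed.

(** This is the filter generated by F and c, by the deduction theorem. *)
Definition adjoin F c : set A := [set a | F (c =>> a)].

Lemma sub_adjoin F c : implicative_filter F -> F `<=` adjoin F c.
Proof. by move=> fF a; apply: (filter_le fF); exact: himpK. Qed.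

Lemma adjoin_filter F c :
  implicative_filter F -> implicative_filter (adjoin F c).
Proof.
move=> fF; split; first exact: sub_adjoin fF _ fF.1.
move=> a b Fca Fcab; apply: (fF.2 _ _ Fca).
exact: filter_le fF (himpS _ _ _) Fcab.
Qed.

Definition maximal_avoiding b F :=
  [/\ implicative_filter F, ~ F b & forall c, ~ F c -> F (c =>> b)].

(** Zorn's lemma for the filters above F that omit b. The last clause of
    [maximal_avoiding] holds because adjoining to M an element c outside M
    produces a larger filter, which therefore contains b. *)
Lemma exists_maximal_avoiding b F : implicative_filter F -> ~ F b ->
  exists2 M, F `<=` M & maximal_avoiding b M.
Proof.
move=> fF nFb.
(* Taking the union with F makes the empty chain admissible. *)
pose P X := implicative_filter (F `|` X) /\ ~ (F `|` X) b.
have [C PC totC|X [[fM nMb] maxX]] := @Zorn_bigcup _ P.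
  split; last by move=> [//|[X /PC[_ nXb] Xb]]; apply: nXb; right.
  split=> [|a c]; first by left; exact: fF.1.
  move=> [Fa|[X CX Xa]] [Fac|[Y CY Yac]].
  - by left; apply: fF.2 Fac.
  - by have [|Fc|Yc] := (PC _ CY).1.2 a c (or_introl Fa);
      [right|left|right; exists Y].
  - by have [|Fc|Xc] := (PC _ CX).1.2 a c (or_intror Xa);
      [left|left|right; exists X].
  - case: (totC _ _ CX CY) => [XY|YX].
      by have [|Fc|Yc] := (PC _ CY).1.2 a c (or_intror (XY _ Xa));
        [right|left|right; exists Y].
    by have [|Fc|Xc] := (PC _ CX).1.2 a c (or_intror Xa);
      [right; exact: YX|left|right; exists X].
exists (F `|` X); first by move=> a; left.
split=> // c nMc; apply: contrapT => nMcb.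
set N := adjoin (F `|` X) c.
have MN : F `|` X `<=` N by exact: sub_adjoin.
apply: (maxX N).
  rewrite properEneq; split; last by move=> a Xa; apply: MN; right.
  by apply/eqP => XN; apply: nMc; right; rewrite XN /N /adjoin /= hle_refl;
    exact: fM.1.
rewrite /P; have -> : F `|` N = N.
  by apply/setUidPr => a Fa; apply: MN; left.
by split; first exact: adjoin_filter.
Qed.

End Filters.

Section PrimeFilters.
Variable A : h0veeAlgType.
Implicit Types (P : set A) (a b : A).

Definition prime_filter P :=
  [/\ implicative_filter P, ~ P hzero & forall a b, P (a +v b) -> P a \/ P b].

(** If P contains neither a nor c, then both imply b modulo P, hence so does
    their join. *)
Lemma maximal_avoiding_prime b P : maximal_avoiding b P -> prime_filter P.
Proof.
move=> [fP nPb maxP]; split=> //.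
  by apply: contra_not nPb; apply: filter_le fP (hzero_le _).
move=> a c Pac; apply: contrapT => /not_orP[/maxP Pab /maxP Pcb]; apply: nPb.
apply: (fP.2 _ _ Pac); apply: (fP.2 _ _ Pcb).
exact: filter_le fP (hjoin_elim _ _ _) Pab.
Qed.

Lemma neg_filter P a : prime_filter P -> P a -> ~ P (hneg a).
Proof. by move=> [fP nP0 _] Pa /(fP.2 _ _ Pa). Qed.

End PrimeFilters.

(** * The spectrum of an algebra *)

Definition spectrum (A : h0veeAlgType) : Type := {P : set A | prime_filter P}.

Definition phi (A : h0veeAlgType) (a : A) : set (spectrum A) :=
  [set P | sval P a].

(** The topology generated by the complements of the sets [phi a], which are
    closed under binary intersection because phi preserves joins. *)
Definition spectrum_open (A : h0veeAlgType) (U : set (spectrum A)) : Prop :=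
  forall P, U P -> exists2 a, ~ phi a P & ~` phi a `<=` U.

Section SpectrumTopology.
Variable A : h0veeAlgType.
Implicit Types (P Q : spectrum A) (a b : A) (U V : set (spectrum A)).

Lemma spectrum_eq P Q : sval P = sval Q -> P = Q.
Proof. by case: P Q => [P hP] [Q hQ] /= PQ; exact: eq_exist. Qed.

Lemma phi1 : @phi A hone = setT.
Proof. by apply/seteqP; split=> // -[P [[]]]. Qed.

Lemma phi0 : @phi A hzero = set0.
Proof. by apply/seteqP; split=> // -[P []]. Qed.

Lemma phiU a b : phi (a +v b) = phi a `|` phi b.
Proof.
apply/seteqP; split=> -[P [fP nP0 prP]]; first exact: prP.
by case; apply: filter_le fP _; [exact: hle_joinl|exact: hle_joinr].
Qed.

Lemma spectrum_openT : @spectrum_open A setT.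
Proof. by move=> P _; exists hzero => //; case: (svalP P). Qed.

Lemma spectrum_openI : setI_closed (@spectrum_open A).
Proof.
move=> U V oU oV P [/oU[a nPa aU] /oV[b nPb bV]]; exists (a +v b).
  by rewrite phiU => -[].
by rewrite phiU setCU => Q [? ?]; split; [exact: aU|exact: bV].
Qed.

Lemma spectrum_open_bigU (I : Type) (f : I -> set (spectrum A)) :
  (forall i, spectrum_open (f i)) -> spectrum_open (\bigcup_i f i).
Proof.
move=> of_ P [i _ /of_[a nPa af]]; exists a => // Q /af fQ.
by exists i.
Qed.

End SpectrumTopology.

HB.instance Definition _ (A : h0veeAlgType) := gen_eqMixin (spectrum A).
HB.instance Definition _ (A : h0veeAlgType) := gen_choiceMixin (spectrum A).
HB.instance Definition _ (A : h0veeAlgType) :=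
  isOpenTopological.Build (spectrum A) (@spectrum_openT A) (@spectrum_openI A)
    (@spectrum_open_bigU A).

Section Spectrum.
Variable A : h0veeAlgType.
Implicit Types (P Q : spectrum A) (a b : A) (U V : set (spectrum A)).

(** F is any filter, not only a point, so that the lemma also applies to {1}.
    The maximality of Q matters for b = 0, where it makes Q a maximal proper
    filter. *)
Lemma exists_maximal_point (F : set A) a b :
  implicative_filter F -> ~ F (a =>> b) ->
  exists Q : spectrum A, [/\ F `<=` sval Q, sval Q a &
    maximal_avoiding b (sval Q)].
Proof.
move=> fF nFab.
have [M FM maxM] := exists_maximal_avoiding (adjoin_filter a fF) nFab.
exists (exist _ M (maximal_avoiding_prime maxM)); split=> //=.
  by move=> c /(sub_adjoin a fF) /FM.
by apply: FM; rewrite /adjoin /= hle_refl; exact: fF.1.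
Qed.

Definition spectrum_base : set (set (spectrum A)) := [set ~` phi a | a in setT].

Lemma open_spectrum U : open U <-> spectrum_open U.
Proof. by []. Qed.

Lemma open_phiC a : open (~` phi a).
Proof. by apply/open_spectrum => P nPa; exists a. Qed.

Lemma closed_phi a : closed (phi a).
Proof. by rewrite -openC; exact: open_phiC. Qed.

Lemma spectrum_basis : basis spectrum_base.
Proof.
split=> [_ [a _ <-]|P U /=]; first exact: open_phiC.
rewrite nbhsE => -[V [/open_spectrum oV /oV[a nPa aV]] VU].
by exists (~` phi a); [split=> //; exists a|exact: subset_trans VU].
Qed.

Lemma specialization_spectrum P Q :
  specialization P Q <-> sval P `<=` sval Q.
Proof.
split=> [PQ a Pa|PQ U].
  apply: contrapT => nQa.
  have [_ [-> /(_ Pa)//]] : [set P] `&` ~` phi a !=set0.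
  by apply: PQ; apply: open_nbhs_nbhs; split=> //; exact: open_phiC.
rewrite nbhsE => -[V [/open_spectrum oV /oV[a nQa aV]] VU].
by exists P; split=> //; apply: VU; apply: aV => /PQ.
Qed.

(** The forward inclusion is modus ponens; the converse is the prime filter
    theorem. *)
Lemma downset_phiD a b : downset (phi a `&` ~` phi b) = ~` phi (a =>> b).
Proof.
apply/seteqP; split=> [P [Q [Qa nQb] /specialization_spectrum PQ] /PQ Qab|P].
  by apply: nQb; have [fQ _ _] := svalP Q; exact: fQ.2 Qa Qab.
have [fP _ _] := svalP P.
move=> /(exists_maximal_point fP)[Q [PQ Qa [_ nQb _]]].
by exists Q; [|exact/specialization_spectrum].
Qed.

(** An ultrafilter F of sets of points converges to the prime filter of those
    a with phi a in F. *)
Lemma compact_phiC a : compact (~` phi a).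
Proof.
rewrite compact_ultra => F uF FnA.
have FN : ~ F set0 by exact: filter_not_empty.
have prP : prime_filter [set b | F (phi b)].
  split=> [||b c /=]; last first.
  - rewrite phiU => Fbc.
    have [|Fnb] := in_ultra_setVsetC (phi b) uF; first by left.
    right; apply: filterS (filterI Fbc Fnb).
    by move=> Q [[]].
  - by rewrite /= phi0.
  - split=> [|b c /= Fb Fbc]; first by rewrite /= phi1; exact: filterT.
    apply: filterS (filterI Fb Fbc) => Q [Qb Qbc].
    by have [fQ _ _] := svalP Q; exact: fQ.2 Qb Qbc.
exists (exist _ _ prP); split=> [/= Fa|U].
  by apply: FN; rewrite -(setICr (phi a)); exact: filterI.
rewrite nbhsE => -[V [/open_spectrum oV /oV[b nFb bV]] VU].
have [//|Fnb] := in_ultra_setVsetC (phi b) uF.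
by apply: filterS Fnb; exact: subset_trans VU.
Qed.

Lemma closure_point P : closure [set P] = [set Q | sval P `<=` sval Q].
Proof. by apply/seteqP; split=> Q /specialization_spectrum. Qed.

(** The sets [phi a] form a base of closed sets, so Y is the intersection of
    those that contain it. *)
Lemma closed_spectrum (Y : set (spectrum A)) P : closed Y ->
  (forall a, Y `<=` phi a -> sval P a) -> Y P.
Proof.
move=> cY YP; apply: contrapT => nYP.
have /open_spectrum/(_ _ nYP)[a nPa aY] : open (~` Y) by rewrite openC.
apply: nPa; apply: YP => Q YQ; apply: contrapT => nQa.
exact: aY nQa YQ.
Qed.

(** The generic point of an irreducible closed set Y of filters is the
    intersection of Y. *)
Lemma sober_spectrum : sober (spectrum A).
Proof.
move=> Y cY [[P0 YP0] irrY].
have prY : prime_filter [set a | Y `<=` phi a].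
  split=> [||a b /=].
  - split=> [|a b /= Ya Yab Q YQ]; first by rewrite /= phi1.
    by have [fQ _ _] := svalP Q; exact: fQ.2 (Ya _ YQ) (Yab _ YQ).
  - by move=> /(_ _ YP0); rewrite phi0.
  - rewrite phiU => Yab.
    have YE : Y = (Y `&` phi a) `|` (Y `&` phi b).
      by rewrite -setIUr; apply/esym/setIidPl.
    have := irrY _ _ (closedI cY (@closed_phi a)) (closedI cY (@closed_phi b)).
    by case/(_ YE) => ->; [left|right]; exact: subIsetr.
pose P : spectrum A := exist _ _ prY.
have YE : Y = closure [set P].
  rewrite closure_point; apply/seteqP; split=> [Q YQ a /= Ya|Q PQ].
    exact: Ya.
  by apply: closed_spectrum => // a Ya; exact: PQ.
exists P; split=> // Q; rewrite YE !closure_point => /seteqP[PQ QP].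
by apply: spectrum_eq; apply/seteqP; split; [exact: (QP Q)|exact: (PQ P)].
Qed.

Lemma spectrum_base_compact U : spectrum_base U -> compact U.
Proof. by move=> [a _ <-]; exact: compact_phiC. Qed.

Lemma spectrum_baseI U V :
  spectrum_base U -> spectrum_base V -> spectrum_base (U `&` V).
Proof.
by move=> [a _ <-] [b _ <-]; exists (a +v b) => //; rewrite phiU setCU.
Qed.

Lemma spectrum_base_imp U V : spectrum_base U -> spectrum_base V ->
  dual_base spectrum_base (~` downset (U `&` ~` V)).
Proof.
move=> [a _ <-] [b _ <-]; exists (b =>> a) => //.
by rewrite setCK -downset_phiD setCK setIC.
Qed.

Lemma spectrum_baseT : spectrum_base setT.
Proof. by exists hzero => //; rewrite phi0 setC0. Qed.

End Spectrum.

HB.instance Definition _ (A : h0veeAlgType) :=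
  Topological_isH0VeeSpace.Build (spectrum A) (@spectrum_basis A)
    (@spectrum_base_compact A) (@spectrum_baseI A) (@spectrum_base_imp A)
    (@spectrum_baseT A) (@sober_spectrum A).

Lemma sbase_spectrum (A : h0veeAlgType) (a : A) : sbase (~` phi a).
Proof. by exists a. Qed.

Lemma DX_phi (A : h0veeAlgType) (a : A) : DX (phi a).
Proof. by exists a. Qed.

Lemma DX_spectrum (A : h0veeAlgType) (U : set (spectrum A)) :
  DX U -> exists a, U = phi a.
Proof. by move=> [a _ aU]; exists a; rewrite -[U]setCK -aU setCK. Qed.

Section StoneanSpectrum.
Variable A : stoneanHilbertType.
Implicit Types (P : set A) (a : A).

(** By Stone's law P contains one of the two negations, and being proper it
    does not contain both. *)
Lemma prime_negP P a : prime_filter P -> ~ P (hneg a) <-> P (hneg (hneg a)).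
Proof.
move=> prP; split=> [nPna|Pnna Pna]; last exact: neg_filter prP Pna Pnna.
have [fP _ /(_ (hneg a) (hneg (hneg a)))] := prP.
by rewrite hneg_stone; case=> //; exact: fP.1.
Qed.

Lemma downset_phi a : downset (phi a) = phi (hneg (hneg a)).
Proof.
have := downset_phiD a hzero; rewrite phi0 setC0 setIT => ->.
by apply/seteqP; split=> P /(prime_negP _ (svalP P)).
Qed.

Lemma DX_downset_spectrum (U : set (spectrum A)) : DX U -> DX (downset U).
Proof. by move=> /DX_spectrum[a ->]; rewrite downset_phi; exact: DX_phi. Qed.

End StoneanSpectrum.

HB.instance Definition _ (A : stoneanHilbertType) :=
  H0VeeSpace_isStonean.Build (spectrum A) (@DX_downset_spectrum A).

(** * The algebra of a space *)

Section SpaceTheory.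
Variable X : h0veeSpaceType.
Implicit Types (U V Y : set X) (x y : X).

Lemma DX_closed U : DX U -> closed U.
Proof. by move=> DU; rewrite -openC; exact: sbase_basis.1 _ DU. Qed.

Lemma DX_up U x y : DX U -> specialization x y -> U x -> U y.
Proof.
move=> /DX_closed cU xy Ux; apply: cU => B /xy[_ [-> Bx]].
by exists x.
Qed.

(** A base of open sets is, through complements, a separation property of the
    sets that make up the dual algebra. *)
Lemma closed_DX_separation Y x : closed Y -> ~ Y x ->
  exists U, [/\ DX U, Y `<=` U & ~ U x].
Proof.
move=> cY nYx.
have /(sbase_basis.2 x)[U [KU Ux] UY] : nbhs x (~` Y).
  by apply: open_nbhs_nbhs; split; rewrite ?openC.
exists (~` U); split; [by rewrite /DX /dual_base /= setCK| |by apply].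
by move=> y Yy Uy; exact: UY Uy Yy.
Qed.

Lemma specialization_DX x y :
  (forall U, DX U -> U x -> U y) -> specialization x y.
Proof.
move=> xy; apply: contrapT => nxy.
have [U [DU xU nUy]] := closed_DX_separation (@closed_closure _ [set x]) nxy.
by apply: nUy; apply: xy DU _; apply: xU; exact: specialization_refl.
Qed.

Lemma DX0 : DX (set0 : set X).
Proof. by rewrite /DX /dual_base /= setC0; exact: sbaseT. Qed.

Lemma DX_imp U V : DX U -> DX V -> DX (~` downset (U `&` ~` V)).
Proof.
by move=> DU DV; have := @sbase_imp X _ _ DV DU; rewrite setCK setIC.
Qed.

Lemma not_downsetD U V x : (~` downset (U `&` ~` V)) x <->
  forall y, specialization x y -> U y -> V y.
Proof.
split=> [nUV y xy Uy|UV [y [Uy nVy] xy]]; last exact: nVy (UV _ xy Uy).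
by apply: contrapT => nVy; apply: nUV; exists y.
Qed.

Lemma DXT : DX (setT : set X).
Proof.
have := DX_imp DX0 DX0; congr DX; apply/seteqP; split=> // x _.
by apply/not_downsetD.
Qed.

Lemma DXU U V : DX U -> DX V -> DX (U `|` V).
Proof. by rewrite /DX /dual_base /= setCU; exact: sbaseI. Qed.

(** The closure of a point is irreducible, and sobriety makes its generic point
    unique. *)
Lemma specialization_anti x y :
  specialization x y -> specialization y x -> x = y.
Proof.
move=> xy yx.
have clxy : closure [set x] = closure [set y].
  apply/seteqP; split=> z.
    exact: specialization_trans yx.
  exact: specialization_trans xy.
have irr : irreducible (closure [set x]).
  split; first by exists x; exact: specialization_refl.
  have clF F : closed F -> F x -> closure [set x] `<=` F.
    by move=> /closure_id {2}-> Fx; apply: closureS => _ ->.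
  move=> F G cF cG FG.
  have [Fx|Gx] : (F `|` G) x by rewrite -FG; exact: specialization_refl.
    by left; apply/seteqP; split; [exact: clF|rewrite FG; exact: subsetUl].
  by right; apply/seteqP; split; [exact: clF|rewrite FG; exact: subsetUr].
have [z [_ zE]] := @sbase_sober X _ (@closed_closure _ [set x]) irr.
by rewrite -(zE x) // -(zE y).
Qed.

End SpaceTheory.

Definition dual_algebra (X : h0veeSpaceType) : Type := {U : set X | DX U}.

Section DualAlgebra.
Variable X : h0veeSpaceType.
Implicit Types U V W : dual_algebra X.

Lemma dual_eq U V : (forall x, sval U x <-> sval V x) -> U = V.
Proof.
case: U V => [U DU] [V DV] /= UV; apply: eq_exist.
by apply/seteqP; split=> x /UV.
Qed.

Definition dual_one : dual_algebra X := exist _ setT (@DXT X).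

Definition dual_imp U V : dual_algebra X :=
  exist _ _ (DX_imp (svalP U) (svalP V)).

Definition dual_join U V : dual_algebra X :=
  exist _ _ (DXU (svalP U) (svalP V)).

Definition dual_zero : dual_algebra X := exist _ set0 (@DX0 X).

(** Kripke semantics of implication over the specialization order. *)
Lemma dual_impP U V x : sval (dual_imp U V) x <->
  forall y, specialization x y -> sval U y -> sval V y.
Proof. exact: not_downsetD. Qed.

Lemma dual_up U x y : specialization x y -> sval U x -> sval U y.
Proof. exact: DX_up (svalP U). Qed.

Lemma dual_eq1 U : (forall x, sval U x) -> U = dual_one.
Proof. by move=> UT; apply: dual_eq. Qed.

Lemma dual_imp_eq1 U V : dual_imp U V = dual_one <-> sval U `<=` sval V.
Proof.
split=> [UV x Ux|UV]; last by apply: dual_eq1 => x; apply/dual_impP => y _ /UV.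
have /dual_impP : sval (dual_imp U V) x by rewrite UV.
by apply=> //; exact: specialization_refl.
Qed.

Lemma dual_impK U V : dual_imp U (dual_imp V U) = dual_one.
Proof.
apply/dual_imp_eq1 => x Ux; apply/dual_impP => y xy _; exact: dual_up Ux.
Qed.

Lemma dual_impS U V W :
  dual_imp (dual_imp U (dual_imp V W))
           (dual_imp (dual_imp U V) (dual_imp U W)) = dual_one.
Proof.
apply/dual_imp_eq1 => x /dual_impP UVW; apply/dual_impP => y xy /dual_impP UV.
apply/dual_impP => z yz Uz.
have /dual_impP := UVW z (specialization_trans xy yz) Uz.
by apply; [exact: specialization_refl|exact: UV].
Qed.

Lemma dual_imp_anti U V :
  dual_imp U V = dual_one -> dual_imp V U = dual_one -> U = V.
Proof.
move=> /dual_imp_eq1 UV /dual_imp_eq1 VU.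
by apply: dual_eq => x; split=> [/UV|/VU].
Qed.

Lemma dual_joinA : associative dual_join.
Proof. by move=> U V W; apply: eq_exist; exact: setUA. Qed.

Lemma dual_joinC : commutative dual_join.
Proof. by move=> U V; apply: eq_exist; exact: setUC. Qed.

Lemma dual_joinI : idempotent_op dual_join.
Proof. by move=> U; apply: dual_eq => x /=; split=> [[]|]; [| |left]. Qed.

Lemma dual_join1 : right_zero dual_one dual_join.
Proof. by move=> U; apply: dual_eq1 => x; right. Qed.

Lemma dual_leEjoin U V : dual_imp U V = dual_one <-> dual_join U V = V.
Proof.
rewrite dual_imp_eq1; split=> [UV|<- x Ux]; last by left.
by apply: dual_eq => x; split=> [[/UV|]|]; [| |right].
Qed.

Lemma dual_zero_le U : dual_imp dual_zero U = dual_one.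
Proof. by apply/dual_imp_eq1. Qed.

End DualAlgebra.

HB.instance Definition _ (X : h0veeSpaceType) :=
  isHilbertAlgebra.Build (dual_algebra X) (@dual_impK X) (@dual_impS X)
    (@dual_imp_anti X).
HB.instance Definition _ (X : h0veeSpaceType) :=
  Hilbert_isHVee.Build (dual_algebra X) (@dual_joinA X) (@dual_joinC X)
    (@dual_joinI X) (@dual_join1 X) (@dual_leEjoin X).
HB.instance Definition _ (X : h0veeSpaceType) :=
  HVee_isH0Vee.Build (dual_algebra X) (@dual_zero_le X).

Lemma dual_leP (X : h0veeSpaceType) (U V : dual_algebra X) :
  U <=h V <-> sval U `<=` sval V.
Proof. exact: dual_imp_eq1. Qed.

Lemma dual_negE (X : h0veeSpaceType) (U : dual_algebra X) :
  sval (hneg U) = ~` downset (sval U).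
Proof. by rewrite /hneg /himp /= setC0 setIT. Qed.

(** Since (U] is itself in the dual algebra, it is an up-set as well as a
    down-set; its complement is then a down-set, so double negation gives back
    (U]. *)
Lemma dual_stone (X : stoneanSpaceType) (U : dual_algebra X) :
  hneg U +v hneg (hneg U) = hone.
Proof.
apply: dual_eq1 => x.
have [Ux|nUx] := pselect (downset (sval U) x); last by left; rewrite dual_negE.
right; rewrite dual_negE => -[y]; rewrite dual_negE => nUy xy; apply: nUy.
exact: DX_up (DX_downset _ (svalP U)) xy Ux.
Qed.

HB.instance Definition _ (X : stoneanSpaceType) :=
  H0Vee_isStonean.Build (dual_algebra X) (@dual_stone X).

HB.instance Definition _ (X : h0veeSpaceType) := gen_eqMixin (dual_algebra X).

(** * The two functors *)

Section SpectrumMap.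
Variables (A B : h0veeAlgType) (h : A -> B).
Hypothesis mh : neg_morphism h.

Lemma neg_morphism0 : h hzero = hzero.
Proof.
have [h1 _ _ hn] := mh.
have negone (C : h0veeAlgType) : hneg (hone : C) = hzero.
  exact: himp1.
by rewrite -[in LHS]negone hn h1 negone.
Qed.

Lemma preimage_prime_filter P : prime_filter P -> prime_filter (h @^-1` P).
Proof.
have [h1 hi hj _] := mh; move=> [fP nP0 prP]; split=> [||a b /=].
- split=> [|a b /= Pa Pab]; first by rewrite /= h1; exact: fP.1.
  exact: fP.2 Pa (filter_le fP (hi _ _) Pab).
- by rewrite /= neg_morphism0.
- by rewrite hj; exact: prP.
Qed.

Definition spectrum_map (P : spectrum B) : spectrum A :=
  exist _ _ (preimage_prime_filter (svalP P)).

Lemma spectral_spectrum_map : spectral spectrum_map.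
Proof. by move=> _ [a _ <-]; exact: (sbase_spectrum (h a)). Qed.

End SpectrumMap.

(** A point Q above the image of P is reached from any maximal proper filter R
    above P: for a in Q, Stone's law gives that P contains the double negation
    of h a, and R, being maximal, then contains h a. *)
Lemma neg_map_spectrum_map (A B : stoneanHilbertType) (h : A -> B)
  (mh : neg_morphism h) : neg_map (spectrum_map mh).
Proof.
split; first exact: spectral_spectrum_map.
have [h1 _ _ hn] := mh => P Q /specialization_spectrum PQ.
have [fP nP0 _] := svalP P.
have nP10 : ~ sval P (hone =>> hzero) by rewrite himp1.
have [R [PR _ [_ _ maxR]]] := exists_maximal_point fP nP10.
exists R; split; apply/specialization_spectrum => // a Qa /=.
apply: contrapT => /maxR; apply/(prime_negP _ (svalP R)); apply: PR.
apply/(prime_negP _ (svalP P)); rewrite -hn => /PQ.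
exact: neg_filter (svalP Q) Qa.
Qed.

Section DualMap.
Variables (X Y : stoneanSpaceType) (f : X -> Y).
Hypothesis mf : neg_map f.

Lemma DX_preimage U : DX U -> DX (f @^-1` U).
Proof. exact: mf.1. Qed.

Definition dual_map (U : dual_algebra Y) : dual_algebra X :=
  exist _ _ (DX_preimage (svalP U)).

(** The lifting property of f says that f commutes with the formation of
    down-sets, hence with negation. *)
Lemma downset_preimage U : DX U -> downset (f @^-1` U) = f @^-1` downset U.
Proof.
move=> DU; apply/seteqP; split=> x [y Uy xy].
  by exists (f y) => //; exact: spectral_specialization mf.1 xy.
have [z [xz yz]] := mf.2 _ _ xy.
by exists z => //; exact: DX_up yz Uy.
Qed.

Lemma neg_morphism_dual_map : neg_morphism dual_map.
Proof.
split=> [|U V|U V|U]; try exact: dual_eq.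
  apply/dual_leP => x /dual_impP UV; apply/dual_impP => y xy; apply: UV.
  exact: spectral_specialization mf.1 xy.
apply: eq_exist; rewrite /= !setC0 !setIT.
by rewrite (downset_preimage (svalP U)).
Qed.

End DualMap.

Definition spectrum_functor : functor (opposite NSH) NMS.
Proof.
refine (@Functor (opposite NSH) NMS (fun A : stoneanHilbertType => spectrum A)
  (fun A B (h : NSH_hom B A) =>
     exist _ _ (neg_map_spectrum_map (svalP h))
       : NMS_hom (spectrum A) (spectrum B))
  _ _).
- by move=> A; apply: eq_exist; apply/funext => P; exact: spectrum_eq.
- by move=> A B C g f; apply: eq_exist; apply/funext => P; exact: spectrum_eq.
Defined.

Definition dual_functor : functor NMS (opposite NSH).
Proof.
refine (@Functor NMS (opposite NSH) (fun X : stoneanSpaceType => dual_algebra X)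
  (fun X Y (f : NMS_hom X Y) =>
     exist _ _ (neg_morphism_dual_map (svalP f))
       : NSH_hom (dual_algebra Y) (dual_algebra X))
  _ _).
- by move=> X; apply: eq_exist; apply/funext => U; exact: dual_eq.
- by move=> X Y Z g f; apply: eq_exist; apply/funext => U; exact: dual_eq.
Defined.

(** * The two natural isomorphisms *)

Lemma bijection_inverse (S T : Type) (f : S -> T) :
  injective f -> (forall y, exists x, f x = y) ->
  exists2 g : T -> S, cancel f g & cancel g f.
Proof.
move=> injf /choice[g gK]; exists g => // x; apply: injf; exact: gK.
Qed.

(** The map epsilon goes from a space to its bidual, against the direction in
    which an equivalence asks for the isomorphism. *)
Lemma naturally_isomorphic_sym (C D : category) (F G : functor C D) :
  naturally_isomorphic F G -> naturally_isomorphic G F.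
Proof.
move=> [eta [nat isoeta]]; have inv a := cid (isoeta a).
exists (fun a => sval (inv a)); split=> [a b f|a]; last first.
  by exists (eta a); case: (inv a) => g [].
case: (inv a) (inv b) => [ga [ea1 ea2]] [gb [eb1 eb2]] /=.
rewrite -[LHS](comp_idr) -ea2 compA -[compm (compm gb _) _]compA -nat.
by rewrite [compm gb _]compA eb1 comp_idl.
Qed.

Section AlgebraIso.
Variable A : stoneanHilbertType.

Definition phi_dual (a : A) : dual_algebra (spectrum A) := exist _ _ (DX_phi a).

Lemma phi_dual_imp a b : phi_dual (a =>> b) = phi_dual a =>> phi_dual b.
Proof. by apply: eq_exist; rewrite downset_phiD setCK. Qed.

Lemma phi_dual_neg a : phi_dual (hneg a) = hneg (phi_dual a).
Proof.
by rewrite /hneg phi_dual_imp; congr (_ =>> _); apply: eq_exist; exact: phi0.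
Qed.

Lemma phi_dual1 : phi_dual hone = hone.
Proof. by apply: eq_exist; exact: phi1. Qed.

Lemma phi_dual_join a b : phi_dual (a +v b) = phi_dual a +v phi_dual b.
Proof. by apply: eq_exist; exact: phiU. Qed.

Lemma neg_morphism_phi : neg_morphism phi_dual.
Proof.
split; [exact: phi_dual1| |exact: phi_dual_join|exact: phi_dual_neg].
by move=> a b; rewrite phi_dual_imp; exact: hle_refl.
Qed.

Lemma phi_le a b : @phi A a `<=` phi b -> a <=h b.
Proof.
move=> ab; apply: contrapT => nab.
have f1 : implicative_filter [set c : A | c = hone].
  by split=> // c d /= ->; rewrite himp1.
have [Q [_ Qa [_ nQb _]]] := exists_maximal_point f1 nab.
exact: nQb (ab Q Qa).
Qed.

Lemma phi_dual_inj : injective phi_dual.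
Proof. by move=> a b [ab]; apply: himp_anti; apply: phi_le; rewrite ab. Qed.

Lemma phi_dual_surj U : exists a, phi_dual a = U.
Proof.
case: U => U DU; have [a aU] := DX_spectrum DU.
by exists a; apply: eq_exist.
Qed.

Definition phi_hom : NSH_hom A (dual_algebra (spectrum A)) :=
  exist _ phi_dual neg_morphism_phi.

Lemma is_iso_phi : @is_iso (opposite NSH) _ _ phi_hom.
Proof.
have [g phiK gK] := bijection_inverse phi_dual_inj phi_dual_surj.
have mg : neg_morphism g.
  split=> [|U V|U V|U]; try by apply: phi_dual_inj;
    rewrite ?phi_dual1 ?phi_dual_join ?phi_dual_neg !gK.
  suff -> : g (U =>> V) = g U =>> g V by exact: hle_refl.
  by apply: phi_dual_inj; rewrite phi_dual_imp !gK.
by exists (exist _ g mg); split; apply: eq_exist; apply/funext.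
Qed.

End AlgebraIso.

Section SpaceIso.
Variable X : h0veeSpaceType.
Implicit Types (x : X) (U V : dual_algebra X) (P : spectrum (dual_algebra X)).

Lemma point_prime_filter x :
  prime_filter [set U : dual_algebra X | sval U x].
Proof.
split=> //; split=> // U V /= Ux /dual_impP; apply=> //.
exact: specialization_refl.
Qed.

Definition epsilon x : spectrum (dual_algebra X) :=
  exist _ _ (point_prime_filter x).

Lemma epsilon_inj : injective epsilon.
Proof.
move=> x y [xy]; have {}xy (U : dual_algebra X) : sval U x <-> sval U y.
  by have := congr1 (@^~ U) xy; rewrite /= => ->.
by apply: specialization_anti; apply: specialization_DX => U DU;
  have [] := xy (exist _ U DU).
Qed.

(** D(X) need not be closed under intersection, so the premises are discharged
    one at a time: V holds on the intersection of W with the others exactly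
    when W -> V holds on the intersection of the others, which is an up-set. *)
Lemma filter_bigcap (P : set (dual_algebra X)) (s : seq (dual_algebra X)) V :
  implicative_filter P -> (forall W, W \in s -> P W) ->
  (forall x, (forall W, W \in s -> sval W x) -> sval V x) -> P V.
Proof.
move=> fP; elim: s V => [|W s IHs] V sP sV.
  by have -> : V = hone by [apply: dual_eq1 => x; exact: sV]; exact: fP.1.
apply: (fP.2 W); first by apply: sP; rewrite mem_head.
apply: IHs => [W' sW'|x sx]; first by apply: sP; rewrite inE sW' orbT.
apply/dual_impP => y xy Wy; apply: sV => W'; rewrite inE => /predU1P[->//|sW'].
exact: dual_up xy (sx _ sW').
Qed.

(** Compactness of the complement of V: the traces on it of the members of a
    filter omitting V have the finite intersection property. *)
Lemma filter_compact (P : set (dual_algebra X)) V :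
  implicative_filter P -> (\bigcap_(W in P) sval W) `<=` sval V -> P V.
Proof.
move=> fP PV; apply: contrapT => nPV.
pose F : set_system X := [set S | exists2 s : seq (dual_algebra X),
  (forall W, W \in s -> P W) &
  (forall x, ~ sval V x -> (forall W, W \in s -> sval W x) -> S x)].
have FF : ProperFilter F.
  apply: Build_ProperFilter_ex => [S [s sP sS]|].
    apply: contrapT => nS; apply: nPV; apply: (filter_bigcap fP sP) => x sx.
    by apply: contrapT => nVx; apply: nS; exists x; exact: sS.
  split=> [|S T [s sP sS] [t tP tT]|S T ST [s sP sS]].
  - by exists [::].
  - exists (s ++ t) => [W|x nVx st]; first by rewrite mem_cat => /orP[/sP|/tP].
    by split; [apply: sS|apply: tT] => // W Ws; apply: st;
      rewrite mem_cat Ws ?orbT.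
  - by exists s => // x nVx sx; apply: ST; exact: sS.
have FV : F (~` sval V) by exists [::].
have [x [nVx clFx]] := @sbase_compact X _ (svalP V) F FF FV.
apply: nVx; apply: PV => W PW; apply: (DX_closed (svalP W)) => B Bx.
have FW : F (sval W).
  exists [:: W] => [W'|y _]; first by rewrite mem_seq1 => /eqP->.
  by apply; rewrite mem_seq1.
exact: clFx FW Bx.
Qed.

(** The intersection Y of a prime filter is irreducible, and its generic point
    is the one sought. *)
Lemma epsilon_surj P : exists x, epsilon x = P.
Proof.
have [fP nP0 prP] := svalP P.
pose Y := \bigcap_(W in sval P) sval W.
have cY : closed Y by apply: closed_bigI => W _; exact: DX_closed (svalP W).
have YP V : Y `<=` sval V -> sval P V by exact: filter_compact fP.
have irrY : irreducible Y.
  split=> [|F G cF cG YFG].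
    by apply/set0P/eqP => Y0; apply: nP0; apply: YP; rewrite Y0.
  have sep Z : closed Z -> Z `<=` Y -> Y <> Z ->
      exists U : dual_algebra X, Z `<=` sval U /\ ~ sval P U.
    move=> cZ ZY YZ; have [y Yy nZy] : exists2 y, Y y & ~ Z y.
      apply: contrapT => nY; apply: YZ; apply/seteqP; split=> // y Yy.
      by apply: contrapT => nZy; apply: nY; exists y.
    have [U [DU ZU nUy]] := closed_DX_separation cZ nZy.
    by exists (exist _ U DU); split=> // /Yy.
  apply: contrapT => /not_orP[YF YG].
  have [|U [FU nPU]] := sep _ cF _ YF; first by rewrite YFG; exact: subsetUl.
  have [|V [GV nPV]] := sep _ cG _ YG; first by rewrite YFG; exact: subsetUr.
  suff /prP[] : sval P (U +v V) by [].
  by apply: YP; rewrite YFG; exact: setUSS.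
have [x [Yx _]] := @sbase_sober X _ cY irrY.
exists x; apply: spectrum_eq; apply/seteqP; split=> W /= => [Wx|PW].
  by apply: YP; rewrite Yx => y xy; exact: dual_up xy Wx.
have : Y x by rewrite Yx; exact: specialization_refl.
exact.
Qed.

Lemma spectral_epsilon : spectral epsilon.
Proof. by move=> _ [U _ <-]; exact: svalP U. Qed.

Lemma spectral_epsilon_inv g :
  cancel epsilon g -> cancel g epsilon -> spectral g.
Proof.
move=> eK gK U KU.
have DU : DX (~` U) by rewrite /DX /dual_base /= setCK.
exists (exist _ _ DU) => //.
apply/seteqP; split=> P; rewrite -[P]gK /preimage /= eK.
  by move=> /contrapT.
by move=> Ux; apply.
Qed.

End SpaceIso.

Lemma neg_map_bij (X Y : stoneanSpaceType) (f : X -> Y) (g : Y -> X) :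
  cancel f g -> cancel g f -> spectral f -> spectral g -> neg_map f.
Proof.
move=> fK gK sf sg; split=> // x y /(spectral_specialization sg).
rewrite fK => xgy; exists (g y); rewrite gK; split=> //.
exact: specialization_refl.
Qed.

Lemma epsilon_iso (X : stoneanSpaceType) :
  exists2 e : NMS_hom X (spectrum (dual_algebra X)),
    sval e = @epsilon X & @is_iso NMS _ _ e.
Proof.
have [g eK gK] := bijection_inverse (@epsilon_inj X) (@epsilon_surj X).
have se := @spectral_epsilon X; have sg := spectral_epsilon_inv eK gK.
exists (exist _ _ (neg_map_bij eK gK se sg)) => //.
exists (exist _ _ (neg_map_bij gK eK sg se)).
by split; apply: eq_exist; apply/funext.
Qed.

Theorem theorem5p7 : dually_equivalent NSH NMS.
Proof.
exists spectrum_functor, dual_functor; split.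
  exists phi_hom; split; last exact: is_iso_phi.
  by move=> A B f; apply: eq_exist; apply/funext => a; exact: dual_eq.
apply: naturally_isomorphic_sym.
exists (fun X => s2val (cid2 (epsilon_iso X))).
split=> [X Y f|X]; last by case: cid2.
case: cid2 => eY /= eYE _; case: cid2 => eX /= eXE _.
apply: eq_exist; rewrite /= eYE eXE.
by apply/funext => x; exact: spectrum_eq.
Qed.
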